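(* For any $\{f_1,\dots,f_m\}\subset\mathcal{F}$ and $N\in\mathbb{N}$, the covariance matrices $\Sigma_m^{(N)}=\mathbb{V}((\mathbb{G}^{(N)}(f_1),\dots,\mathbb{G}^{(N)}(f_m)))$ are such that $\Sigma_m^{(0)}-\Sigma_m^{(N)}$ is positive definite.
   Context: $\mathbb{N}=\{0,1,\dots\}$, $\mathbb{N}_*=\{1,2,\dots\}$. $P$ is a probability measure on a measurable space $(\mathcal{X},\mathcal{A})$, $P(f)=\int f\,dP$. For each $N\in\mathbb{N}_*$, $\mathcal{A}^{(N)}=\{A_1^{(N)},\dots,A_{m_N}^{(N)}\}\subset\mathcal{A}$ is a finite partition of $\mathcal{X}$ with $m_N\geqslant2$ and $\min_jP(A_j^{(N)})>0$; consecutive partitions are different. $\mathcal{F}$ is a class of measurable real functions on $\mathcal{X}$, uniformly bounded by $M<+\infty$, pointwise measurable (each $f\in\mathcal{F}$ is a pointwise limit of a sequence from a fixed countable subset of $\mathcal{F}$), such that $1_Af\in\mathcal{F}$ for all $f\in\mathcal{F}$ and $A\in\mathcal{A}^{(1)}\cup\dots\cup\mathcal{A}^{(N)}$, and satisfying one of the following entropy conditions, with $d_Q^2(f,g)=\int(f-g)^2dQ$: (VC) for $c_0>0,\nu_0>0$ the minimum number of balls of $d_Q$-radius $\varepsilon$ needed to cover $\mathcal{F}$ is at most $c_0/\varepsilon^{\nu_0}$, uniformly over all discrete probability measures $Q$ on $(\mathcal{X},\mathcal{A})$; (BR) for $b_0>0,r_0\in(0,1)$ the least number of brackets $\{f:g_-\leqslant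 f\leqslant g_+\}$ with $d_P(g_-,g_+)<\varepsilon$ needed to cover $\mathcal{F}$ is at most $\exp(b_0^2/\varepsilon^{2r_0})$. $\mathbb{G}=\mathbb{G}^{(0)}$ is the $P$-Brownian bridge indexed by $\mathcal{F}$: centered Gaussian, linear in $f$, with $\mathrm{Cov}(\mathbb{G}(f),\mathbb{G}(g))=P(fg)-P(f)P(g)$. Write, for short, $\mathbb{G}^{(N)}(A)=\mathbb{G}^{(N)}(1_A)$ for a set $A\in\mathcal{A}$, and $\mathbb{E}(f|A)=P(f1_A)/P(A)$. For $N\in\mathbb{N}_*$, $$\mathbb{G}^{(N)}(f)=\mathbb{G}^{(N-1)}(f)-\sum_{j=1}^{m_N}\mathbb{E}(f|A_j^{(N)})\,\mathbb{G}^{(N-1)}(A_j^{(N)}).$$ $\mathbb{V}(\cdot)$ denotes the covariance matrix of a random vector.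
   Formalization: ''Positive definite'' is read as positive semidefinite (symmetric with nonnegative quadratic form), since the strict claim is false: for N = 0 the difference is the zero matrix, and for N ≥ 1 it is degenerate when some f_i = 0. *)

(* Defs.v *)
From HB Require Import structures.
From mathcomp Require Import all_boot all_order all_algebra.
From mathcomp Require Import all_classical all_reals all_analysis.

Set Implicit Arguments.
Unset Strict Implicit.
Unset Printing Implicit Defensive.

Import Order.TTheory GRing.Theory Num.Theory.
Import numFieldNormedType.Exports.

Local Open Scope classical_set_scope.
Local Open Scope ring_scope.

Section partitions.
Context (d : measure_display) (X : measurableType d) (R : realType)
  (P : probability X R).

(* Partitions are numbered from 1; [m 0] and [A 0] are never used. *)
Definition partition_sequence (m : nat -> nat)
    (A : forall n, 'I_(m n) -> set X) : Prop :=
  forall n, (1 <= n)%N ->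
    [/\ (2 <= m n)%N,
        (forall j, measurable (A n j)),
        partition [set: 'I_(m n)] (A n) [set: X],
        (forall j, (0 < P (A n j))%E) &
        range (A n) <> range (A n.+1)].

Definition cell_mean (f : X -> R) (A : set X) : R :=
  fine 'E_P[f * \1_A] / fine (P A).

End partitions.

Section function_class.
Context (d : measure_display) (X : measurableType d) (R : realType).
Implicit Types (F : set (X -> R)) (P Q : probability X R).

Definition pointwise_measurable F : Prop :=
  exists F0 : set (X -> R),
    [/\ F0 `<=` F, countable F0 &
        forall f, F f -> exists u : nat -> X -> R,
          (forall n, F0 (u n)) /\ (forall x, u n x @[n --> \oo] --> f x)].

Definition L2dist Q (f g : X -> R) : \bar R :=
  sqrte (\int[Q]_x (((f x - g x) ^+ 2)%:E)).

Definition discrete_probability Q : Prop :=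
  exists (x : nat -> X) (p : nat -> R),
    (forall n, 0 <= p n) /\
    (forall B, measurable B ->
       Q B = (\sum_(0 <= n <oo) (p n)%:E * \d_(x n) B)%E).

(* Centres need not belong to [F]; the value is +oo if no finite cover exists. *)
Definition covering_number Q F (eps : R) : \bar R :=
  ereal_inf [set (k%:R)%:E | k in [set k : nat |
    exists c : 'I_k -> X -> R,
      (forall i, measurable_fun [set: X] (c i)) /\
      (forall f, F f -> exists i, (L2dist Q f (c i) < eps%:E)%E)]].

Definition bracketing_number P F (eps : R) : \bar R :=
  ereal_inf [set (k%:R)%:E | k in [set k : nat |
    exists lo hi : 'I_k -> X -> R,
      (forall i, [/\ measurable_fun [set: X] (lo i), measurable_fun [set: X] (hi i) &
                     (L2dist P (lo i) (hi i) < eps%:E)%E]) /\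
      (forall f, F f -> exists i, forall x, lo i x <= f x <= hi i x)]].

(* The bound cannot hold for arbitrarily large [eps], since a nonempty class
   needs at least one ball; hence the usual range 0 < eps < 1. *)
Definition entropy_VC F : Prop :=
  exists c0 nu0 : R, [/\ 0 < c0, 0 < nu0 &
    forall eps, 0 < eps < 1 -> forall Q, discrete_probability Q ->
      (covering_number Q F eps <= (c0 / eps `^ nu0)%:E)%E].

Definition entropy_BR P F : Prop :=
  exists b0 r0 : R, [/\ 0 < b0, 0 < r0 < 1 &
    forall eps, 0 < eps ->
      (bracketing_number P F eps <=
         (expR (b0 ^+ 2 / eps `^ (2 * r0)))%:E)%E].

End function_class.

Section gaussian.
Context (d : measure_display) (W : measurableType d) (R : realType)
  (Pr : probability W R).

(* [normal_prob m 0] is a junk value, so the degenerate law is given apart. *)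
Definition gaussian_variable (Y : W -> R) : Prop :=
  measurable_fun [set: W] Y /\
  exists m s : R, forall B : set R, measurable B ->
    Pr (Y @^-1` B) = if s == 0 then \d_m B else normal_prob m s B.

Definition covariance_matrix (k : nat) (Y : 'I_k -> W -> R) : 'M[R]_k :=
  \matrix_(i, j) fine (covariance Pr (Y i) (Y j)).

End gaussian.
Arguments gaussian_variable {d W R} Pr Y.
Arguments covariance_matrix {d W R} Pr {k} Y.

Section brownian_bridge.
Context (d d' : measure_display) (X : measurableType d) (W : measurableType d')
  (R : realType) (P : probability X R) (Pr : probability W R).

(* The recursion evaluates the bridge at indicators, which need not lie in [F]. *)
Definition bridge_index (F : set (X -> R)) : set (X -> R) :=
  F `|` [set \1_A | A in measurable].

(* [G] is total for convenience; nothing is assumed about it off [I].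
   Measurability of each [G f] is part of [gaussian_variable]. *)
Definition brownian_bridge (I : set (X -> R)) (G : (X -> R) -> W -> R) : Prop :=
  [/\ (* finite-dimensional marginals are Gaussian vectors *)
      (forall (k : nat) (f : 'I_k -> X -> R) (a : 'I_k -> R),
         (forall i, I (f i)) ->
         gaussian_variable Pr (\sum_(i < k) a i *: G (f i))),
      (forall f, I f -> ('E_Pr[G f] = 0)%E),
      (forall (a b : R) (f g : X -> R),
         I f -> I g -> I (a *: f + b *: g) ->
         {ae Pr, forall w, G (a *: f + b *: g) w = a * G f w + b * G g w}) &
      (forall f g, I f -> I g ->
         covariance Pr (G f) (G g) = ('E_P[f * g] - 'E_P[f] * 'E_P[g])%E)].

Fixpoint raked (m : nat -> nat) (A : forall n, 'I_(m n) -> set X)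
    (G : (X -> R) -> W -> R) (N : nat) (f : X -> R) : W -> R :=
  if N is n.+1 then
    raked A G n f - \sum_(j < m n.+1)
      cell_mean P f (A n.+1 j) *: raked A G n \1_(A n.+1 j)
  else G f.

End brownian_bridge.

Definition positive_semidefinite (R : realType) (k : nat) (S : 'M[R]_k) : Prop :=
  S^T = S /\ forall v : 'cV[R]_k, 0 <= (v^T *m S *m v) 0 0.

(* Main.v *)
Require Import Defs.
From HB Require Import structures.
From mathcomp Require Import all_boot all_order all_algebra.
From mathcomp Require Import all_classical all_reals all_analysis.
From mathcomp Require Import measurable_realfun.

Set Implicit Arguments.
Unset Strict Implicit.
Unset Printing Implicit Defensive.

Import Order.TTheory GRing.Theory Num.Theory.
Import numFieldNormedType.Exports.

Local Open Scope classical_set_scope.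
Local Open Scope ring_scope.

(** [raked P A G N f] is a finite linear combination of values of [G] at [f] and
    at cell indicators; the same combination of the functions themselves is
    [raked P A id N f], i.e. [T_1 (... (T_N f))] where [T_n f] subtracts from [f]
    its conditional mean given the [n]-th partition.  Since [G] has the
    covariance of [P], the quadratic form of [Sigma^(0) - Sigma^(N)] at [v] is
    [Var_P h - Var_P (T_1 (... (T_N h)))] with [h = sum_i v_i f_i].  Each [T_n]
    lowers the variance, because [T_n h] is uncorrelated with [h - T_n h]. *)

(** * Square-integrable functions and covariance as a real bilinear form *)

Section square_integrable.
Context d (T : measurableType d) (R : realType).

Lemma Lfun2_integral_sqr_lty (mu : {measure set T -> \bar R}) (f : T -> R) :
  measurable_fun [set: T] f -> (\int[mu]_x (f x ^+ 2)%:E < +oo)%E ->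
  f \in Lfun mu 2%:E.
Proof.
move=> mf foo; rewrite inE; apply/andP; split; rewrite inE//=.
rewrite /finite_norm unlock /Lnorm poweR_lty//.
by under eq_integral do rewrite /= powR_mulrn// -normrX ger0_norm ?sqr_ge0//.
Qed.

Variable P : probability T R.
Implicit Types f g h : T -> R.

(** Real values make bilinearity a plain ring identity; on square-integrable functions [fine] loses
    nothing, by [covariance_Lfun2_fin_num]. *)
Definition rcov f g : R := fine (covariance P f g).

Lemma Lfun2_Lfun1 f : f \in Lfun P 2%:E -> f \in Lfun P 1.
Proof. by apply: Lfun_subset12; exact: fin_num_measure. Qed.

Lemma Lfun2_bounded f (M : R) : measurable_fun [set: T] f ->
  (forall x, `|f x| <= M) -> f \in Lfun P 2%:E.
Proof.
move=> mf fM; apply: Lfun2_integral_sqr_lty => //.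
apply: (@le_lt_trans _ _ (\int[P]_x (cst (M ^+ 2)%:E x))%E).
  apply: ge0_le_integral => //.
  - by move=> x _; rewrite lee_fin sqr_ge0.
  - by apply/measurable_EFinP; exact: measurable_funX.
  - move=> x _; rewrite lee_fin -real_normK ?num_real//.
    by rewrite lerXn2r ?nnegrE// (le_trans _ (fM x)).
by rewrite integral_cst// [X in (_ * X)%E](@probability_setT _ _ _ P) mule1 ltry.
Qed.

Lemma Lfun2_indic (A : set T) : measurable A -> (\1_A : T -> R) \in Lfun P 2%:E.
Proof.
move=> mA; apply: (@Lfun2_bounded _ 1); first exact: measurable_indic.
by move=> x; rewrite indicE; case: (_ \in _); rewrite ?normr1 ?normr0.
Qed.

Lemma Lfun2_lin (a : R) f g : f \in Lfun P 2%:E -> g \in Lfun P 2%:E ->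
  a *: f + g \in Lfun P 2%:E.
Proof. exact: (Lfun_submod_closed P (lee1n 2)).2. Qed.

Lemma Lfun2_0 : (0 : T -> R) \in Lfun P 2%:E.
Proof. exact: (Lfun_submod_closed P (lee1n 2)).1. Qed.

Lemma Lfun2_sum (I : Type) (s : seq I) (a : I -> R) (F : I -> T -> R) :
  (forall i, F i \in Lfun P 2%:E) -> \sum_(i <- s) a i *: F i \in Lfun P 2%:E.
Proof.
move=> F2; elim/big_ind: _ => [|f g f2 g2|i _]; first exact: Lfun2_0.
  by rewrite -[f]scale1r; exact: Lfun2_lin.
by rewrite -[_ *: _]addr0; exact: (Lfun2_lin _ (F2 i) Lfun2_0).
Qed.

Lemma rcovC f g : rcov f g = rcov g f.
Proof. by rewrite /rcov covarianceC. Qed.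

Lemma covariance_Lfun2_fin_num f g : f \in Lfun P 2%:E -> g \in Lfun P 2%:E ->
  covariance P f g \is a fin_num.
Proof.
by move=> f2 g2; rewrite covariance_fin_num ?Lfun2_mul_Lfun1// Lfun2_Lfun1.
Qed.

Lemma rcov_linl (a : R) f g h : f \in Lfun P 2%:E -> g \in Lfun P 2%:E ->
  h \in Lfun P 2%:E -> rcov (a *: f + g) h = a * rcov f h + rcov g h.
Proof.
move=> f2 g2 h2.
have -> : a *: f + g = (a \o* f) \+ g.
  by apply/funext => x /=; rewrite [LHS]/(a * f x + g x) mulrC.
have af2 : a \o* f \in Lfun P 2%:E by apply: Lfun_scale; rewrite ?ler1n.
rewrite /rcov covarianceDl// covarianceZl ?Lfun2_mul_Lfun1// ?Lfun2_Lfun1//.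
by rewrite fineD ?fin_numM ?covariance_Lfun2_fin_num// fineM ?covariance_Lfun2_fin_num.
Qed.

Lemma rcov0l h : rcov 0 h = 0.
Proof. by rewrite /rcov covariance_cst_l. Qed.

Lemma rcov_suml (I : Type) (s : seq I) (a : I -> R) (F : I -> T -> R) h :
  (forall i, F i \in Lfun P 2%:E) -> h \in Lfun P 2%:E ->
  rcov (\sum_(i <- s) a i *: F i) h = \sum_(i <- s) a i * rcov (F i) h.
Proof.
move=> F2 h2; elim: s => [|i s IH]; first by rewrite !big_nil rcov0l.
by rewrite !big_cons rcov_linl ?Lfun2_sum// IH.
Qed.

(** Pythagoras: the cross terms vanish, and what [f] adds is its own variance, which is
    nonnegative. *)
Lemma rcov_le_uncorrelated f g : f \in Lfun P 2%:E -> g \in Lfun P 2%:E ->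
  rcov f g = 0 -> rcov g g <= rcov (f + g) (f + g).
Proof.
move=> f2 g2 fg0; rewrite -[f]scale1r.
have fg2 := Lfun2_lin 1 f2 g2.
rewrite rcov_linl// ![rcov _ (_ + _)]rcovC !rcov_linl//.
rewrite [rcov g f]rcovC fg0 mul1r mulr0 !addr0 add0r lerDr.
by rewrite mul1r /rcov fine_ge0// variance_ge0.
Qed.

End square_integrable.

(** Bilinearity in both arguments; semidefiniteness thereby becomes a comparison of two
    variances. *)
Lemma covariance_matrix_form d (W : measurableType d) (R : realType)
    (Pr : probability W R) (k : nat) (Y : 'I_k -> W -> R) (v : 'cV[R]_k) :
  (forall i, Y i \in Lfun Pr 2%:E) ->
  (v^T *m covariance_matrix Pr Y *m v) 0 0 =
  rcov Pr (\sum_i v i 0 *: Y i) (\sum_i v i 0 *: Y i).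
Proof.
move=> Y2; rewrite rcov_suml ?Lfun2_sum// mxE.
apply: eq_bigr => i _; rewrite mulrC; congr (_ * _).
rewrite rcovC rcov_suml// mxE; apply: eq_bigr => j _.
by rewrite !mxE.
Qed.

(** * Removing the cell means of one partition *)

Section raking.
Context d (T : measurableType d) (R : realType) (P : probability T R).
Implicit Types f g h : T -> R.

(** For a partition [B] with cells of positive mass, this is [h] minus its conditional expectation
    given [B], the operator [T_n] when [B] is the [n]-th partition. *)
Definition cell_residual (n : nat) (B : 'I_n -> set T) h : T -> R :=
  h - \sum_(j < n) cell_mean P h (B j) *: \1_(B j).

Lemma mul_indic_Lfun1 f (A : set T) : measurable A -> f \in Lfun P 2%:E ->
  f * \1_A \in Lfun P 1.
Proof. by move=> mA f2; apply: Lfun2_mul_Lfun1 => //; exact: Lfun2_indic. Qed.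

Lemma expectation_indic_lin (a : R) f g (A : set T) : measurable A ->
  f \in Lfun P 2%:E -> g \in Lfun P 2%:E ->
  fine 'E_P[(a *: f + g) * \1_A] =
  a * fine 'E_P[f * \1_A] + fine 'E_P[g * \1_A].
Proof.
move=> mA f2 g2.
have -> : (a *: f + g) * \1_A = (a \o* (f * \1_A)) \+ (g * \1_A).
  apply/funext => x.
  change ((a * f x + g x) * \1_A x = f x * \1_A x * a + g x * \1_A x).
  by rewrite mulrDl -mulrA [a * _]mulrC.
have fA := mul_indic_Lfun1 mA f2; have gA := mul_indic_Lfun1 mA g2.
rewrite expectationD ?Lfun_scale// expectationZl//.
by rewrite fineD ?fin_numM ?expectation_fin_num// fineM ?expectation_fin_num.
Qed.

Lemma cell_mean_lin (a : R) f g (A : set T) : measurable A ->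
  f \in Lfun P 2%:E -> g \in Lfun P 2%:E ->
  cell_mean P (a *: f + g) A = a * cell_mean P f A + cell_mean P g A.
Proof.
by move=> mA f2 g2; rewrite /cell_mean expectation_indic_lin// mulrDl mulrA.
Qed.

Section one_partition.
Variables (n : nat) (B : 'I_n -> set T).
Hypotheses (mB : forall j, measurable (B j))
  (pB : partition [set: 'I_n] B [set: T]) (B_gt0 : forall j, (0 < P (B j))%E).

Lemma cell_residual_Lfun2 h : h \in Lfun P 2%:E ->
  cell_residual B h \in Lfun P 2%:E.
Proof.
move=> h2; rewrite /cell_residual addrC -scaleN1r; apply: Lfun2_lin => //.
by apply: Lfun2_sum => j; exact: Lfun2_indic.
Qed.

(** By disjointness only the [i]-th term survives on [B i]. *)
Lemma expectation_sum_indic (c : 'I_n -> R) (i : 'I_n) :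
  fine 'E_P[(\sum_(j < n) c j *: \1_(B j)) * \1_(B i)] = c i * fine (P (B i)).
Proof.
have [_ tB _] := pB.
have -> : (\sum_(j < n) c j *: \1_(B j)) * \1_(B i) = (c i \o* \1_(B i)) :> (T -> R).
  apply/funext => x.
  change ((\sum_(j < n) c j *: \1_(B j) : T -> R) x * \1_(B i) x =
    \1_(B i) x * c i).
  rewrite fct_sumE !indicE.
  have [xi|xi] := boolP (x \in B i); last by rewrite mulr0 mul0r.
  rewrite (bigD1 i)//= big1 ?addr0; last first.
    move=> j ji; change (c j * \1_(B j) x = 0); rewrite indicE.
    have [xj|] := boolP (x \in B j); last by rewrite mulr0.
    move: ji; rewrite (tB j i) ?eqxx//.
    by exists x; split; exact: set_mem.
  change (c i * \1_(B i) x * true%:R = true%:R * c i).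
  by rewrite indicE xi !mulr1 mul1r.
rewrite expectationZl ?Lfun2_Lfun1 ?Lfun2_indic// expectation_indic//.
by rewrite fineM// fin_num_measure.
Qed.

(** Multiplying the mean of [h] over [B i] by the mass of [B i], which is positive, gives back the
    integral of [h] over that cell. *)
Lemma expectation_residual_indic h (i : 'I_n) : h \in Lfun P 2%:E ->
  fine 'E_P[cell_residual B h * \1_(B i)] = 0.
Proof.
move=> h2; rewrite /cell_residual addrC -scaleN1r expectation_indic_lin//; last first.
  by apply: Lfun2_sum => j; exact: Lfun2_indic.
rewrite expectation_sum_indic /cell_mean divfK ?mulN1r ?addNr//.
by rewrite gt_eqF// fine_gt0// B_gt0 ltey_eq fin_num_measure.
Qed.

(** The cells cover the space, so the residual is the sum of its restrictions to them, each of mean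
    zero. *)
Lemma expectation_residual h : h \in Lfun P 2%:E ->
  fine 'E_P[cell_residual B h] = 0.
Proof.
move=> h2; have r2 := cell_residual_Lfun2 h2.
have [cB tB _] := pB.
have -> : cell_residual B h = \sum_(j < n) cell_residual B h * \1_(B j).
  apply/funext => x; rewrite fct_sumE.
  have [i _ xi] : cover [set: 'I_n] B x by rewrite cB.
  rewrite (bigD1 i)//= big1 ?addr0; last first.
    move=> j ji; change (cell_residual B h x * \1_(B j) x = 0); rewrite indicE.
    have [xj|] := boolP (x \in B j); last by rewrite mulr0.
    by move: ji; rewrite (tB j i) ?eqxx//; exists x; split => //; exact: set_mem.
  change (cell_residual B h x = cell_residual B h x * \1_(B i) x).
  by rewrite indicE mem_set// mulr1.
(* Additivity of the expectation requires integrable summands, so integrability is carried along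
   with the zero mean. *)
pose null g := g \in Lfun P 1 /\ fine 'E_P[g] = 0.
suff [] : null (\sum_(j < n) cell_residual B h * \1_(B j)) by [].
apply: (big_ind null) => [|g1 g2 [g11 g10] [g21 g20]|j _].
- by split; [exact: Lfun_cst | rewrite expectation_cst].
- split; first exact: rpredD.
  by rewrite expectationD// fineD ?expectation_fin_num// g10 g20 addr0.
- by split; [exact: mul_indic_Lfun1 | exact: expectation_residual_indic].
Qed.

Lemma rcov_residual_indic h (i : 'I_n) : h \in Lfun P 2%:E ->
  rcov P (cell_residual B h) \1_(B i) = 0.
Proof.
move=> h2; have r2 := cell_residual_Lfun2 h2.
have i2 : (\1_(B i) : T -> R) \in Lfun P 2%:E by exact: Lfun2_indic.
rewrite /rcov covarianceE ?mul_indic_Lfun1 ?Lfun2_Lfun1//.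
rewrite fineB ?fin_numM ?expectation_fin_num ?mul_indic_Lfun1 ?Lfun2_Lfun1//.
rewrite fineM ?expectation_fin_num ?Lfun2_Lfun1//.
by rewrite expectation_residual_indic// expectation_residual// mul0r subrr.
Qed.

(** [h] splits into [e], a combination of cell indicators, and the residual, which is uncorrelated
    with each indicator and hence with [e]. *)
Lemma rcov_residual_le h : h \in Lfun P 2%:E ->
  rcov P (cell_residual B h) (cell_residual B h) <= rcov P h h.
Proof.
move=> h2; have r2 := cell_residual_Lfun2 h2.
set e := \sum_(j < n) cell_mean P h (B j) *: (\1_(B j) : T -> R).
have e2 : e \in Lfun P 2%:E by apply: Lfun2_sum => j; exact: Lfun2_indic.
have er0 : rcov P e (cell_residual B h) = 0.
  rewrite rcov_suml//; last by move=> j; exact: Lfun2_indic.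
  by apply: big1 => j _; rewrite rcovC rcov_residual_indic// mulr0.
have -> : rcov P h h = rcov P (e + cell_residual B h) (e + cell_residual B h).
  by rewrite [e + _]addrC subrK.
exact: rcov_le_uncorrelated.
Qed.

End one_partition.
End raking.

(** * Parallel linear combinations of bridge values and of functions *)

Section shared_combinations.
Context (T W : Type) (R : realType) (I : set (T -> R)) (G : (T -> R) -> W -> R).

(* [Y] and [h] are the same finite linear combination, of variables [G f] and of
   functions [f] respectively; no linearity of [G] is involved. *)
Inductive same_combination : (W -> R) -> (T -> R) -> Prop :=
| same_combination0 : same_combination 0 0
| same_combination_gen f : I f -> same_combination (G f) f
| same_combination_lin (a : R) Y1 h1 Y2 h2 :
    same_combination Y1 h1 -> same_combination Y2 h2 ->
    same_combination (a *: Y1 + Y2) (a *: h1 + h2).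

Lemma same_combination_sum (J : Type) (s : seq J) (a : J -> R)
    (Y : J -> W -> R) (h : J -> T -> R) :
  (forall j, same_combination (Y j) (h j)) ->
  same_combination (\sum_(j <- s) a j *: Y j) (\sum_(j <- s) a j *: h j).
Proof.
move=> Yh; elim: s => [|j s IH]; first by rewrite !big_nil; exact: same_combination0.
by rewrite !big_cons; exact: same_combination_lin.
Qed.

End shared_combinations.

(** * Transfer of covariances from functions to bridge values *)

Section covariance_of_combinations.
Context d d' (T : measurableType d) (W : measurableType d') (R : realType)
  (P : probability T R) (Pr : probability W R).
Variables (I : set (T -> R)) (G : (T -> R) -> W -> R).
Hypotheses (I2 : forall f, I f -> f \in Lfun P 2%:E)
  (G2 : forall f, I f -> G f \in Lfun Pr 2%:E)
  (GI : forall f g, I f -> I g -> rcov Pr (G f) (G g) = rcov P f g).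

Lemma same_combination_Lfun2 Y h : same_combination I G Y h ->
  Y \in Lfun Pr 2%:E /\ h \in Lfun P 2%:E.
Proof.
elim=> [|f If|a Y1 h1 Y2 h2 _ [Y12 h12] _ [Y22 h22]].
- by split; exact: Lfun2_0.
- by split; [exact: G2 | exact: I2].
- by split; exact: Lfun2_lin.
Qed.

(** Bilinearity reduces the claim to pairs of generators, where it is [GI]. *)
Lemma same_combination_rcov Y h Y' h' : same_combination I G Y h ->
  same_combination I G Y' h' -> rcov Pr Y Y' = rcov P h h'.
Proof.
move=> + Yh'; have [Y'2 h'2] := same_combination_Lfun2 Yh'.
elim=> [|f If|a Y1 h1 Y2 h2 Yh1 IH1 Yh2 IH2].
- by rewrite !rcov0l.
- have Gf2 := G2 If; have f2 := I2 If.
  (* With a generator fixed on the left, a second induction treats the right argument; symmetry of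
     [rcov] brings it to the left. *)
  elim: Yh' {Y'2 h'2} => [|g Ig|a Y1 h1 Y2 h2 Yh1 IH1 Yh2 IH2].
  + by rewrite rcovC [RHS]rcovC !rcov0l.
  + exact: GI.
  + have [Y12 h12] := same_combination_Lfun2 Yh1.
    have [Y22 h22] := same_combination_Lfun2 Yh2.
    rewrite rcovC [RHS]rcovC !rcov_linl//.
    by rewrite ![rcov _ _ (G f)]rcovC ![rcov _ _ f]rcovC IH1 IH2.
- have [Y12 h12] := same_combination_Lfun2 Yh1.
  have [Y22 h22] := same_combination_Lfun2 Yh2.
  by rewrite !rcov_linl// IH1 IH2.
Qed.

Variables (m : nat -> nat) (A : forall n, 'I_(m n) -> set T).

(* Raking the identity performs the same operations on functions. *)
Lemma raked_same_combination N f : I f ->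
  (forall n (j : 'I_(m n.+1)), I \1_(A j)) ->
  same_combination I G (raked P A G N f) (raked P A id N f).
Proof.
(* [f] stays general because the induction hypothesis is also applied to the cell indicators. *)
move=> + IA; elim: N f => [|N IH] f If; first exact: same_combination_gen.
rewrite /= addrC -scaleN1r [X in same_combination _ _ _ X]addrC.
rewrite -[X in same_combination _ _ _ (X + _)]scaleN1r.
apply: same_combination_lin; last exact: IH.
by apply: same_combination_sum => j; apply: IH; exact: IA.
Qed.

End covariance_of_combinations.

(** * Raking of functions: linearity and decrease of variance *)

Section raked_functions.
Context d (T : measurableType d) (R : realType) (P : probability T R).
Variables (m : nat -> nat) (A : forall n, 'I_(m n) -> set T).
Hypothesis hA : partition_sequence P A.
Implicit Types f g h : T -> R.

Let mA n (j : 'I_(m n.+1)) : measurable (A j).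
Proof. by have [] := hA (ltn0Sn n). Qed.

Lemma raked_id_Lfun2 N f : f \in Lfun P 2%:E ->
  raked P A id N f \in Lfun P 2%:E.
Proof.
elim: N f => [//|N IH] f f2 /=.
rewrite addrC -scaleN1r; apply: Lfun2_lin; last exact: IH.
by apply: Lfun2_sum => j; apply: IH; exact: Lfun2_indic.
Qed.

Lemma raked_id_lin N (a : R) f g : f \in Lfun P 2%:E -> g \in Lfun P 2%:E ->
  raked P A id N (a *: f + g) = a *: raked P A id N f + raked P A id N g.
Proof.
elim: N f g => [//|N IH] f g f2 g2 /=; rewrite IH// scalerBr.
rewrite [RHS]addrACA -opprD scaler_sumr -big_split/=; congr (_ - _).
by apply: eq_bigr => j _; rewrite cell_mean_lin// scalerDl scalerA.
Qed.

Lemma raked_id0 N : raked P A id N 0 = 0.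
Proof.
(* With [a = -1] and both functions zero, the right-hand side cancels. *)
have := raked_id_lin N (- 1) (Lfun2_0 P) (Lfun2_0 P).
by rewrite scaler0 addr0 scaleN1r addNr.
Qed.

Lemma raked_id_sum N (J : Type) (s : seq J) (a : J -> R) (F : J -> T -> R) :
  (forall j, F j \in Lfun P 2%:E) ->
  raked P A id N (\sum_(j <- s) a j *: F j) =
  \sum_(j <- s) a j *: raked P A id N (F j).
Proof.
move=> F2; elim: s => [|j s IH]; first by rewrite !big_nil raked_id0.
by rewrite !big_cons raked_id_lin ?Lfun2_sum// IH.
Qed.

(** The recursion subtracts already raked indicators; linearity moves this correction inside, so
    that the last partition acts first on [h]. *)
Lemma raked_idS N h : h \in Lfun P 2%:E ->
  raked P A id N.+1 h = raked P A id N (cell_residual P (@A N.+1) h).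
Proof.
move=> h2; have A2 j : (\1_(@A N.+1 j) : T -> R) \in Lfun P 2%:E.
  exact: Lfun2_indic.
rewrite /cell_residual addrC -scaleN1r raked_id_lin ?Lfun2_sum//.
by rewrite raked_id_sum// scaleN1r addrC.
Qed.

(** Induction over all [h]: the hypothesis is applied to the residual of [h], whose variance is at
    most that of [h]. *)
Lemma rcov_raked_id_le N h : h \in Lfun P 2%:E ->
  rcov P (raked P A id N h) (raked P A id N h) <= rcov P h h.
Proof.
elim: N h => [//|N IH] h h2; have [_ _ pA A_gt0 _] := hA (ltn0Sn N).
rewrite raked_idS//; apply: (le_trans (IH _ _)).
  exact: cell_residual_Lfun2.
exact: rcov_residual_le.
Qed.

End raked_functions.

(** * Second moments of the Brownian bridge *)

Section bridge.
Context d d' (T : measurableType d) (W : measurableType d') (R : realType)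
  (P : probability T R) (Pr : probability W R).
Variables (I : set (T -> R)) (G : (T -> R) -> W -> R).
Hypotheses (hG : brownian_bridge P Pr I G)
  (I2 : forall f, I f -> f \in Lfun P 2%:E).

Lemma brownian_bridge_covariance f g : I f -> I g ->
  covariance Pr (G f) (G g) = covariance P f g.
Proof.
have [_ _ _ cG] := hG => If Ig; rewrite cG// covarianceE//.
- exact/Lfun2_Lfun1/I2.
- exact/Lfun2_Lfun1/I2.
- by apply: Lfun2_mul_Lfun1; exact: I2.
Qed.

(** [G f] is centered, so its second moment is its variance, which equals that of [f] under [P] and
    is finite. *)
Lemma brownian_bridge_Lfun2 f : I f -> G f \in Lfun Pr 2%:E.
Proof.
have [gG EG _ _] := hG => If.
have mGf : measurable_fun [set: W] (G f).
  (* Measurability is read off the one-term combination with coefficient 1. *)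
  have [+ _] := gG 1%N (fun=> f) (fun=> 1) (fun=> If).
  by rewrite big_ord1 scale1r.
apply: Lfun2_integral_sqr_lty => //.
have : (covariance Pr (G f) (G f) < +oo)%E.
  rewrite brownian_bridge_covariance// ltey_eq.
  by rewrite covariance_Lfun2_fin_num ?I2.
rewrite covariance.unlock EG//= expectation.unlock.
congr (_ < _)%E; apply: eq_integral => w _; congr (_%:E).
change ((G f w - 0) * (G f w - 0) = G f w ^+ 2).
by rewrite subr0 expr2.
Qed.

End bridge.

Theorem proposition8 (R : realType) (dX dW : measure_display)
    (X : measurableType dX) (P : probability X R)
    (W : measurableType dW) (Pr : probability W R)
    (m : nat -> nat) (A : forall n, 'I_(m n) -> set X)
    (hA : partition_sequence P A)
    (N : nat) (F : set (X -> R)) (M : R)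
    (hFmeas : forall f, F f -> measurable_fun [set: X] f)
    (hFbound : forall f x, F f -> `|f x| <= M)
    (hFpm : pointwise_measurable F)
    (hFcells : forall n (j : 'I_(m n)) f,
       (1 <= n <= N)%N -> F f -> F (\1_(A n j) * f))
    (hFentropy : entropy_VC F \/ entropy_BR P F)
    (G : (X -> R) -> W -> R)
    (hG : brownian_bridge P Pr (bridge_index F) G)
    (k : nat) (f : 'I_k -> X -> R) (hf : forall i, F (f i)) :
  positive_semidefinite
    (covariance_matrix Pr (fun i => raked P A G 0 (f i)) -
     covariance_matrix Pr (fun i => raked P A G N (f i))).
Proof.
(* Members of [F] are square-integrable by the uniform bound [M], indicators by the bound 1. *)
have [mA I2] : (forall n (j : 'I_(m n.+1)), measurable (A n.+1 j)) /\
    (forall g, bridge_index F g -> g \in Lfun P 2%:E).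
  split=> [n j|g [Fg|[B mB <-]]]; first by have [] := hA _ (ltn0Sn n).
    by apply: (@Lfun2_bounded _ _ _ P g M) => [|x]; [exact: hFmeas | exact: hFbound].
  exact: Lfun2_indic.
have G2 := brownian_bridge_Lfun2 hG I2.
have GI g h : bridge_index F g -> bridge_index F h ->
    rcov Pr (G g) (G h) = rcov P g h.
  by move=> Ig Ih; rewrite /rcov (brownian_bridge_covariance hG I2).
have fI i : bridge_index F (f i) by left; exact: hf.
have AI n (j : 'I_(m n.+1)) : bridge_index F \1_(A n.+1 j).
  by right; exists (A n.+1 j) => //; exact: mA.
have rc n i := raked_same_combination P G n (fI i) AI.
have Y2 n i := (same_combination_Lfun2 I2 G2 (rc n i)).1.
split; first by apply/matrixP => i j; rewrite !mxE !(covarianceC _ _ (raked _ _ _ _ (f i))).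
move=> v; rewrite mulmxBr mulmxBl mxE [X in _ + X]mxE.
rewrite !covariance_matrix_form ?subr_ge0//; try exact: Y2.
(* Used at [0] and at [N], this moves both variances from [Pr] to [P]. *)
have sc n := same_combination_sum (index_enum 'I_k) (fun i => v i 0) (rc n).
rewrite !(same_combination_rcov I2 G2 GI (sc _) (sc _)).
have f2 i := I2 _ (fI i).
(* Linearity gathers the raked [f i] into one raked function [h], the combination of the [f i]
   weighted by [v]; raking zero times leaves [h] by computation. *)
rewrite -(raked_id_sum hA)//.
by apply: rcov_raked_id_le => //; exact: Lfun2_sum.
Qed.
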